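(* Let $(X,d)$ be a complete $b$-rectangular metric space with parameter $s\ge 1$, let $T:X\to X$ be a mapping, and let $\varphi:X\to\mathbb{R}^+$ be a lower semicontinuous function. Suppose that $T$ is a $C$-class-$F$-generalized weakly contractive mapping, i.e. there exist $\psi\in\Phi$, $\phi\in\Phi_u$ and $F\in\mathcal{C}$ such that for all $x,y\in X$ $$\psi\bigl(s^{2}d(Tx,Ty)+\varphi(Tx)+\varphi(Ty)\bigr)\le F\bigl(\psi(M(x,y,d,T,\varphi)),\,\phi(M(x,y,d,T,\varphi))\bigr),$$ where $$M(x,y,d,T,\varphi)=\max\{d(x,y)+\varphi(x)+\varphi(y),\ d(x,Tx)+\varphi(x)+\varphi(Tx),\ d(y,Ty)+\varphi(y)+\varphi(Ty)\}.$$ Then $T$ has a unique fixed point $z\in X$ (so $z=Tz$), and $\varphi(z)=0$.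
   Context: $\mathbb{R}^+=[0,+\infty)$. A $b$-rectangular metric space with parameter (coefficient) $s\ge1$ is a nonempty set $X$ with a function $d:X\times X\to[0,+\infty)$ such that for all $x,y\in X$: (1) $d(x,y)=0$ iff $x=y$; (2) $d(x,y)=d(y,x)$; (3) $d(x,y)\le s[d(x,u)+d(u,v)+d(v,y)]$ for all distinct points $u,v\in X\setminus\{x,y\}$. A sequence $(x_n)$ converges to $x$ if $d(x_n,x)\to0$; it is Cauchy if $d(x_n,x_m)\to0$ as $n,m\to\infty$; $X$ is complete if every Cauchy sequence converges to some point of $X$. A function $\varphi:X\to\mathbb{R}^+$ is lower semicontinuous if for all $x\in X$ and all sequences $x_n\to x$ in $X$, $\varphi(x)\le\liminf_{n\to\infty}\varphi(x_n)$. $\Phi$ is the set of altering distance functions: functions $\psi:[0,\infty)\to[0,\infty)$ that are continuous, nondecreasing, and satisfy $\psi(t)=0$ iff $t=0$. $\Phi_u$ is the set of continuous functions $\phi:[0,\infty)\to[0,\infty)$ with $\phi(t)>0$ for all $t>0$ (and $\phi(0)\ge0$). $\mathcal{C}$ is the set of $C$-class functions: continuous $F:[0,\infty)^2\to\mathbb{R}$ such that for all $p,q\in[0,\infty)$, $F(p,q)\le p$, and $F(p,q)=p$ implies $p=0$ or $q=0$. *)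

(* Defs.v *)
From HB Require Import structures.
From mathcomp Require Import all_boot all_order all_algebra.
From mathcomp Require Import all_classical all_reals all_analysis.

Set Implicit Arguments.
Unset Strict Implicit.
Unset Printing Implicit Defensive.

Import Order.TTheory GRing.Theory Num.Theory.
Import numFieldNormedType.Exports.

Local Open Scope classical_set_scope.
Local Open Scope ring_scope.

Record b_rectangular_metric (R : realType) (X : Type) (s : R)
    (d : X -> X -> R) : Prop := BRectangularMetric {
  brm_ge0 : forall x y, 0 <= d x y;
  brm_eq0 : forall x y, d x y = 0 <-> x = y;
  brm_sym : forall x y, d x y = d y x;
  brm_rect : forall x y u v, u <> v -> u <> x -> u <> y -> v <> x -> v <> y ->
    d x y <= s * (d x u + d u v + d v y)
}.

Definition brm_cvg (R : realType) (X : Type) (d : X -> X -> R)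
    (u : nat -> X) (x : X) : Prop :=
  d (u n) x @[n --> \oo] --> (0 : R).

Definition brm_cauchy (R : realType) (X : Type) (d : X -> X -> R)
    (u : nat -> X) : Prop :=
  d (u nm.1) (u nm.2) @[nm --> (\oo, \oo)] --> (0 : R).

Definition brm_complete (R : realType) (X : Type) (d : X -> X -> R) : Prop :=
  forall u : nat -> X, brm_cauchy d u -> exists x : X, brm_cvg d u x.

(* The liminf is taken in the extended reals: the real-valued liminf is
   meaningless for sequences along which f is unbounded. *)
Definition brm_lsc (R : realType) (X : Type) (d : X -> X -> R)
    (f : X -> R) : Prop :=
  forall (x : X) (u : nat -> X), brm_cvg d u x ->
    ((f x)%:E <= limn_einf (fun n => (f (u n))%:E))%E.

(* Functions on [0, +oo[ (resp. [0, +oo[ ^ 2) are represented by total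
   functions on R (resp. R * R), of which only the restriction to that set is
   constrained; continuity is relative to that set. *)
Record altering_distance (R : realType) (psi : R -> R) : Prop :=
    AlteringDistance {
  altering_ge0 : forall t : R, 0 <= t -> 0 <= psi t;
  altering_continuous : {within `[0, +oo[, continuous psi};
  altering_ndecr : forall t u : R, 0 <= t -> t <= u -> psi t <= psi u;
  altering_eq0 : forall t : R, 0 <= t -> (psi t = 0 <-> t = 0)
}.

Record ultra_altering_distance (R : realType) (phi : R -> R) : Prop :=
    UltraAlteringDistance {
  ultra_altering_ge0 : forall t : R, 0 <= t -> 0 <= phi t;
  ultra_altering_continuous : {within `[0, +oo[, continuous phi};
  ultra_altering_gt0 : forall t : R, 0 < t -> 0 < phi t
}.

Record C_class (R : realType) (F : R * R -> R) : Prop := CClass {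
  C_class_continuous :
    {within [set pq : R * R | 0 <= pq.1 /\ 0 <= pq.2], continuous F};
  C_class_le : forall p q : R, 0 <= p -> 0 <= q -> F (p, q) <= p;
  C_class_eq : forall p q : R, 0 <= p -> 0 <= q ->
    F (p, q) = p -> p = 0 \/ q = 0
}.

Definition contraction_max (R : realType) (X : Type) (d : X -> X -> R)
    (T : X -> X) (varphi : X -> R) (x y : X) : R :=
  Num.max (d x y + varphi x + varphi y)
    (Num.max (d x (T x) + varphi x + varphi (T x))
             (d y (T y) + varphi y + varphi (T y))).

Definition C_class_generalized_weakly_contractive (R : realType) (X : Type)
    (s : R) (d : X -> X -> R) (varphi : X -> R) (T : X -> X) : Prop :=
  exists (psi phi : R -> R) (F : R * R -> R),
    [/\ altering_distance psi, ultra_altering_distance phi, C_class F &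
      forall x y,
        psi (s ^+ 2 * d (T x) (T y) + varphi (T x) + varphi (T y))
          <= F (psi (contraction_max d T varphi x y),
                phi (contraction_max d T varphi x y))].

(* Main.v *)
Require Import Defs.
From HB Require Import structures.
From mathcomp Require Import all_boot all_order all_algebra.
From mathcomp Require Import all_classical all_reals all_analysis.
From mathcomp Require Import zify lra.

Set Implicit Arguments.
Unset Strict Implicit.
Unset Printing Implicit Defensive.

Import Order.TTheory GRing.Theory Num.Theory.
Import numFieldNormedType.Exports.

Local Open Scope classical_set_scope.
Local Open Scope ring_scope.

(** Write M(x, y) for [contraction_max d T varphi x y] and U(x, y) for
    s^2 d(Tx, Ty) + varphi(Tx) + varphi(Ty), so that the hypothesis reads
    psi(U) <= F(psi(M), phi(M)). The functions psi, phi, F enter the proof only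
    through one consequence, a Meir-Keeler condition [C_class_meir_keeler]:
    each level L > 0 has a gap dl > 0 such that M < L + dl forces U <= L - dl.
    Indeed F(psi L, phi L) < psi L strictly, both sides are continuous at L,
    and U <= M always holds, so U > L - dl would leave M within dl of L.

    Everything else is metric. Along an orbit x_n = T^n x_0 the weighted
    lengths of one step and of two steps, d(x_n, x_{n+1}) and d(x_n, x_{n+2})
    plus the values of varphi at the endpoints, jump below every positive level
    that they approach, hence tend to 0 ([orbit_steps_cvg0]). Two-step
    distances are controlled along with one-step distances because the
    rectangular inequality moves along the orbit two indices at a time: it
    needs two intermediate points distinct from each other and from the ends.
    Distinctness along the orbit is free, since the step lengths strictly
    decrease unless a fixed point is reached ([orbit_inj]).

    The factor s^2 is what makes the orbit Cauchy ([orbit_tail_lt]). If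
    d(x_n, x_m) < e, then d(x_n, x_{m+2}) is at most slightly above s e by the
    rectangular inequality, so the gap at level s e brings
    s^2 d(x_{n+1}, x_{m+3}) below s e - dl; a second use of the rectangular
    inequality costs one more factor s and returns d(x_n, x_{m+2}) < e. Thus
    the bound e propagates to the whole tail by induction, simultaneously for
    s = 1 and s > 1.

    A limit z has varphi(z) = 0 by lower semicontinuity. If z <> Tz, then
    M(x_n, z) tends to L = d(z, Tz) + varphi(Tz) > 0, and the gap at L keeps
    d(x_{n+1}, Tz) too small for the rectangular inequality between z and Tz
    through x_n and x_{n+1} ([orbit_limit_fixpoint]). Uniqueness and
    varphi = 0 at fixed points follow from U < M whenever M > 0. *)

(** * From the C-class inequality to a Meir-Keeler gap *)

Lemma altering_distance_gt0 (R : realType) (psi : R -> R) (t : R) :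
  altering_distance psi -> 0 < t -> 0 < psi t.
Proof.
move=> Hpsi t0; rewrite lt_neqAle (altering_ge0 Hpsi (ltW t0)) andbT eq_sym.
by apply/eqP => /(altering_eq0 Hpsi (ltW t0)) tE; rewrite tE ltxx in t0.
Qed.

Lemma within_ge0_continuous_at (R : realType) (f : R -> R) (t : R) :
  {within `[0, +oo[, continuous f} -> 0 < t -> {for t, continuous f}.
Proof.
move=> cf t0.
have sub : [set` Interval (BRight (0 : R)) +oo%O] `<=`
    [set` Interval (BLeft (0 : R)) +oo%O].
  by move=> u /=; rewrite !in_itv /= !andbT => /ltW.
have := continuous_subspaceW sub cf.
rewrite continuous_open_subspace; last exact: interval_open.
by apply; rewrite inE /= in_itv /= t0.
Qed.

Lemma C_class_continuous_at (R : realType) (F : R * R -> R) (p q : R) :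
  C_class F -> 0 < p -> 0 < q -> {for (p, q), continuous F}.
Proof.
move=> HF p0 q0.
pose Q : set (R * R) := [set z | 0 < z.1 /\ 0 < z.2].
have sub : Q `<=` [set z | 0 <= z.1 /\ 0 <= z.2].
  by move=> z [/ltW ? /ltW ?].
have := continuous_subspaceW sub (C_class_continuous HF).
rewrite continuous_open_subspace; first by apply; rewrite inE.
have -> : Q = (fst @^-1` [set x | 0 < x]) `&` (snd @^-1` [set x | 0 < x]) by [].
by apply: openI; apply: open_comp; do ?[exact: open_gt];
  move=> ? _; [exact: cvg_fst | exact: cvg_snd].
Qed.

(** If t < u, monotonicity of [psi] closes the chain
    psi u <= F(psi t, phi t) <= psi t <= psi u into equalities, and the equality
    case of a C-class function forces t = 0, then u = 0. *)
Lemma C_class_altering_le (R : realType) (psi phi : R -> R) (F : R * R -> R)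
    (u t : R) :
  altering_distance psi -> ultra_altering_distance phi -> C_class F ->
  0 <= u -> 0 <= t -> psi u <= F (psi t, phi t) -> u <= t.
Proof.
move=> Hpsi Hphi HF u0 t0 ut; rewrite leNgt; apply/negP => tu.
have psit := altering_ge0 Hpsi t0.
have phit := ultra_altering_ge0 Hphi t0.
have psitu := altering_ndecr Hpsi t0 (ltW tu).
have Fle := C_class_le HF psit phit.
have FE : F (psi t, phi t) = psi t by lra.
have tE : t = 0.
  case: (C_class_eq HF psit phit FE) => [/(altering_eq0 Hpsi t0)//|phi0].
  apply/eqP/contraT; rewrite neq_lt ltNge t0 /= => /(ultra_altering_gt0 Hphi).
  by rewrite phi0 ltxx.
have psi0 : psi t = 0 by apply/(altering_eq0 Hpsi t0).
have psiu : psi u = 0 by have := altering_ge0 Hpsi u0; lra.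
by have := proj1 (altering_eq0 Hpsi u0) psiu; lra.
Qed.

(** Continuity is needed only at the points L > 0 and (psi L, phi L), which are
    interior to the half-line and to the quadrant. *)
Lemma C_class_gap (R : realType) (psi phi : R -> R) (F : R * R -> R) (L : R) :
  altering_distance psi -> ultra_altering_distance phi -> C_class F -> 0 < L ->
  exists2 dl : R, 0 < dl & forall u t, 0 <= u -> 0 <= t ->
    psi u <= F (psi t, phi t) -> t < L + dl -> u <= L - dl.
Proof.
move=> Hpsi Hphi HF L0.
have psiL := altering_distance_gt0 Hpsi L0.
have phiL := ultra_altering_gt0 Hphi L0.
have cpsi := within_ge0_continuous_at (altering_continuous Hpsi) L0.
have cphi := within_ge0_continuous_at (ultra_altering_continuous Hphi) L0.
have cF : {for L, continuous (fun t : R => F (psi t, phi t))}.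
  apply: (@cvg_comp _ _ _ (fun t => (psi t, phi t)) F _
    (nbhs (psi L, phi L))); first exact: (cvg_pair cpsi cphi).
  exact: C_class_continuous_at.
have FL : F (psi L, phi L) < psi L.
  rewrite lt_neqAle (C_class_le HF (ltW psiL) (ltW phiL)) andbT.
  by apply/eqP => /(C_class_eq HF (ltW psiL) (ltW phiL)) []; lra.
(* Values of psi and of F(psi, phi) within e of their values at L cannot cross. *)
pose e := (psi L - F (psi L, phi L)) / 2.
have e0 : 0 < e by rewrite /e; lra.
have [r /= r0 near_r] : nbhs L [set t | `|psi L - psi t| < e /\
    `|F (psi L, phi L) - F (psi t, phi t)| < e].
  exact: filterI (cvgr_dist_lt _ _ cpsi _ e0) (cvgr_dist_lt _ _ cF _ e0).
(* The bound L / 2 keeps L - dl in the domain where psi is monotone. *)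
pose dl := Num.min (r / 2) (L / 2).
have dl0 : 0 < dl by rewrite lt_min; apply/andP; lra.
exists dl => // u t u0 t0 ut tL.
have dlr : dl <= r / 2 by rewrite ge_min lexx.
have dlL : dl <= L / 2 by rewrite ge_min lexx orbT.
rewrite leNgt; apply/negP => Lu.
have le_ut := C_class_altering_le Hpsi Hphi HF u0 t0 ut.
have [|_ Ft] := near_r t; first by rewrite /ball /= ltr_norml; apply/andP; lra.
have [|psidl _] := near_r (L - dl).
  by rewrite /ball /= ltr_norml; apply/andP; lra.
have Ldl0 : 0 <= L - dl by lra.
have := altering_ndecr Hpsi Ldl0 (ltW Lu).
by move: Ft psidl; rewrite !ltr_norml /e => /andP[? ?] /andP[? ?]; lra.
Qed.

(** The classical Meir-Keeler condition asks for U < L when L <= M < L + dl;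
    here the gap covers all smaller M, so that upper estimates of M suffice to
    use it, and U falls short of L by dl, which absorbs the errors of the
    rectangular inequality. *)
Definition meir_keeler_contractive (R : realType) (X : Type) (s : R)
    (d : X -> X -> R) (varphi : X -> R) (T : X -> X) : Prop :=
  forall L : R, 0 < L -> exists2 dl : R, 0 < dl & forall x y,
    contraction_max d T varphi x y < L + dl ->
    s ^+ 2 * d (T x) (T y) + varphi (T x) + varphi (T y) <= L - dl.

Lemma C_class_meir_keeler (R : realType) (X : Type) (s : R)
    (d : X -> X -> R) (varphi : X -> R) (T : X -> X) :
  b_rectangular_metric s d -> (forall x, 0 <= varphi x) ->
  C_class_generalized_weakly_contractive s d varphi T ->
  meir_keeler_contractive s d varphi T.
Proof.
move=> Hd v0 [psi [phi [F [Hpsi Hphi HF HT]]]] L L0.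
have [dl dl0 gap] := C_class_gap Hpsi Hphi HF L0.
exists dl => // x y; apply: gap (HT x y).
  by rewrite !addr_ge0 // mulr_ge0 ?exprn_even_ge0 //; exact: brm_ge0 Hd _ _.
by rewrite le_max !addr_ge0 //; exact: brm_ge0 Hd _ _.
Qed.

(** Taking L = w n shows that w decreases; were its limit L positive, w would
    enter the gap above L and then jump below L. *)
Lemma cvg0_gap (R : realType) (w : nat -> R) :
  (forall n, 0 <= w n) ->
  (forall L, 0 < L -> exists2 dl, 0 < dl &
     forall n, w n < L + dl -> w n.+1 <= L - dl) ->
  w n @[n --> \oo] --> (0 : R).
Proof.
move=> w0 gap.
have wS n : w n.+1 <= w n.
  rewrite leNgt; apply/negP => lt_w.
  have [dl dl0 /(_ n)] := gap _ (le_lt_trans (w0 n) lt_w).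
  by lra.
have ninc : nonincreasing_seq w by apply/nonincreasing_seqP.
have lbw : has_lbound (range w) by exists 0 => _ [n _ <-].
have := nonincreasing_cvgn ninc lbw.
set l := inf _ => wl.
suff -> : 0 = l by [].
apply/eqP/contraT => l_neq0.
have lb n : l <= w n by apply: ge_inf => //; exists n.
have l0 : 0 < l.
  rewrite lt_neqAle l_neq0 /=; apply: lb_le_inf; first by exists (w 0%N), 0%N.
  by move=> _ [n _ <-].
have [dl dl0 gapl] := gap _ l0.
have [N _ /(_ N (leqnn N)) /=] := cvgr_dist_lt _ _ wl _ dl0.
rewrite ltr_norml => /andP[? ?].
by have := gapl N; have := lb N.+1; lra.
Qed.

(** * Fixed points and orbits of Meir-Keeler contractions *)

Section Orbit.
Context (R : realType) (X : Type) (s : R) (d : X -> X -> R)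
  (T : X -> X) (varphi : X -> R).
Hypotheses (s_ge1 : 1 <= s) (d_metric : b_rectangular_metric s d)
  (varphi_ge0 : forall x, 0 <= varphi x)
  (T_mk : meir_keeler_contractive s d varphi T).

Local Notation M := (contraction_max d T varphi).
Local Notation a := (fun x => d x (T x) + varphi x + varphi (T x)).

Let d_ge0 x y : 0 <= d x y. Proof. exact: brm_ge0 d_metric _ _. Qed.
Let dC x y : d x y = d y x. Proof. exact: brm_sym d_metric _ _. Qed.
Let dxx x : d x x = 0. Proof. exact/(brm_eq0 d_metric). Qed.

Let d_eq0 x y : d x y = 0 -> x = y.
Proof. by move/(brm_eq0 d_metric). Qed.

Let s_gt0 : 0 < s. Proof. exact: lt_le_trans ltr01 s_ge1. Qed.

Let d_s2 x y : d x y <= s * d x y /\ s * d x y <= s ^+ 2 * d x y.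
Proof.
have s_ge0 := ltW s_gt0.
by rewrite expr2 -mulrA; split; apply: ler_peMl; rewrite ?mulr_ge0.
Qed.

Lemma meir_keeler_lt x y : 0 < M x y ->
  s ^+ 2 * d (T x) (T y) + varphi (T x) + varphi (T y) < M x y.
Proof. by move=> /T_mk [dl dl0 /(_ x y)]; lra. Qed.

Lemma fixpoint_varphi0 x : T x = x -> varphi x = 0.
Proof.
move=> Tx; have vx := varphi_ge0 x.
apply/eqP/contraT; rewrite neq_lt ltNge vx /= => v0.
have ME : M x x = varphi x + varphi x.
  by rewrite /contraction_max !Tx dxx add0r !maxxx.
have := @meir_keeler_lt x x; rewrite ME Tx dxx.
by lra.
Qed.

Lemma fixpoint_unique x y : T x = x -> T y = y -> x = y.
Proof.
move=> Tx Ty; apply: d_eq0; have dxy := d_ge0 x y.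
apply/eqP/contraT; rewrite neq_lt ltNge dxy /= => d0.
have [? ?] := d_s2 x y.
have ME : M x y = d x y.
  rewrite /contraction_max !Tx !Ty !dxx !fixpoint_varphi0 // !addr0.
  by rewrite maxxx max_l.
have := @meir_keeler_lt x y; rewrite ME Tx Ty !fixpoint_varphi0 //.
by lra.
Qed.

(** M(x, Tx) is the larger of a(x) and a(Tx), while U(x, Tx) >= a(Tx): the
    maximum cannot be a(Tx) unless both vanish. *)
Lemma step_nincr x : a (T x) <= a x.
Proof.
rewrite leNgt; apply/negP => lt_a.
have ME : M x (T x) = a (T x) by rewrite /contraction_max maxA maxxx max_r // ltW.
have := @meir_keeler_lt x (T x); rewrite ME.
have ? := d_ge0 x (T x).
have ? := varphi_ge0 x; have ? := varphi_ge0 (T x).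
by have [? ?] := d_s2 (T x) (T (T x)); lra.
Qed.

Lemma step_lt x : 0 < a x -> a (T x) < a x.
Proof.
move=> a0.
have ME : M x (T x) = a x.
  by rewrite /contraction_max maxA maxxx max_l // step_nincr.
have := @meir_keeler_lt x (T x); rewrite ME => /(_ a0).
by have [? ?] := d_s2 (T x) (T (T x)); lra.
Qed.

(** * Orbits are Cauchy *)

Variable x0 : X.
Local Notation x := (fun n => iter n T x0).

Let b n := d (x n) (x n.+2) + varphi (x n) + varphi (x n.+2).

(** [b] alone need not have the gap property, as M(x_n, x_{n+2}) also involves [a]; the
    maximum of the two has one. *)
Lemma orbit_steps_cvg0 : Num.max (a (x n)) (b n) @[n --> \oo] --> (0 : R).
Proof.
apply: cvg0_gap => [n|L L0]; first by rewrite le_max !addr_ge0.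
have [dl dl0 gap] := T_mk L0.
exists dl => // n; rewrite gt_max ge_max => /andP[aL bL].
have /= aS := step_nincr (x n); have /= aSS := step_nincr (x n.+1).
rewrite /b /= in aL bL *; apply/andP; split.
  have /= := gap (x n) (x n.+1).
  have /= [? ?] := d_s2 (x n.+1) (x n.+2).
  by rewrite !gt_max aL /= => gapa; apply: le_trans (gapa _); lra.
have /= := gap (x n) (x n.+2).
have /= [? ?] := d_s2 (x n.+1) (x n.+3).
by rewrite !gt_max aL bL /= => gapb; apply: le_trans (gapb _); lra.
Qed.

(* This fails only if the orbit reaches a fixed point. *)
Hypothesis step_gt0 : forall n, 0 < a (x n).

Lemma orbit_inj : injective x.
Proof.
have dec m n : (m < n)%N -> a (x n) < a (x m).
  elim: n => // n IHn; rewrite ltnS leq_eqVlt => /predU1P[->|/IHn] /=.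
    exact/step_lt/step_gt0.
  by apply: le_lt_trans; exact: step_nincr.
move=> m n /= mn.
by case: (ltngtP m n) => // /dec; rewrite mn ltxx.
Qed.

Lemma orbit_dist_rect m n : m.+1 <> n -> n.+1 <> m -> m <> n ->
  d (x m) (x n) <=
    s * (d (x m) (x m.+1) + d (x m.+1) (x n.+1) + d (x n.+1) (x n)).
Proof.
by move=> *; apply: (brm_rect d_metric) => /orbit_inj; lia.
Qed.

(** Strong induction on [k], where index n + k + 3 is reached from n + k + 1 by
    the rectangular inequality; the cases k <= 2, for which the four points
    involved are not distinct, are the one-step and two-step bounds. *)
Lemma orbit_tail_lt e : 0 < e -> exists N, forall n k, (N <= n)%N ->
  d (x n) (x (n + k)%N) < e.
Proof.
move=> e0.
have se0 := mulr_gt0 s_gt0 e0.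
have [dl dl0 gap] := T_mk se0.
(* M(x_n, x_{m+2}) exceeds s e by at most 2 s h + 2 h, and the return to
   d(x_n, x_{m+2}) costs 2 s^2 h < dl: both are covered by 4 s^2 h <= dl. *)
pose h := Num.min e (dl / (4 * s ^+ 2)).
have s2 : 0 < 4 * s ^+ 2 by rewrite mulr_gt0 ?exprn_gt0.
have h0 : 0 < h by rewrite lt_min e0 divr_gt0.
have he : h <= e by rewrite ge_min lexx.
have hdl : 4 * (s * (s * h)) <= dl.
  by rewrite (mulrA s) -expr2 mulrA mulrC -ler_pdivlMr // ge_min lexx orbT.
have hs : h <= s * h by rewrite ler_peMl // ltW.
have hs2 : s * h <= s * (s * h) by rewrite ler_pM2l.
have sh0 := mulr_gt0 s_gt0 h0.
have [N _ small] := cvgr0_norm_lt _ orbit_steps_cvg0 _ h0.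
have {}small m : (N <= m)%N -> a (x m) < h /\ b m < h.
  move=> /small /=; rewrite ger0_norm ?gt_max => [/andP[]//|].
  by rewrite le_max !addr_ge0.
exists N => n k Nn; elim/ltn_ind: k => k IHk.
have [/= an bn] := small n Nn.
have vn := varphi_ge0 (x n); have /= vn1 := varphi_ge0 (x n.+1).
case: k IHk => [|[|[|k]]] IHk.
- by rewrite addn0 dxx.
- by rewrite addn1 /=; lra.
- by have /= := varphi_ge0 (x n.+2); rewrite /b addn2 /= in bn *; lra.
have IH : d (x n) (x (n + k.+1)%N) < e by apply: IHk.
have nm : (n < n + k.+1)%N by rewrite addnS ltnS leq_addr.
rewrite !addnS -addnS; move: (n + k.+1)%N nm IH => m nm IH {IHk}.
have Nm : (N <= m)%N := leq_trans Nn (ltnW nm).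
have [/= am _] := small m Nm.
have [/= am1 _] := small m.+1 (leqW Nm).
have [/= am2 _] := small m.+2 (leqW (leqW Nm)).
have vm := varphi_ge0 (x m); have /= vm1 := varphi_ge0 (x m.+1).
have /= vm2 := varphi_ge0 (x m.+2); have /= vm3 := varphi_ge0 (x m.+3).
(* First rectangle: n, m, m + 1, m + 2. *)
have D1 : d (x n) (x m.+2) < s * (e + 2 * h).
  apply: (@le_lt_trans _ _
      (s * (d (x n) (x m) + d (x m) (x m.+1) + d (x m.+1) (x m.+2)))).
    by apply: (brm_rect d_metric) => /orbit_inj; clear -nm; lia.
  by rewrite ltr_pM2l //=; lra.
have G : s * (s * d (x n.+1) (x m.+3)) <= s * e - dl.
  have /= dn := d_ge0 (x n) (x n.+1); have /= dm2 := d_ge0 (x m.+2) (x m.+3).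
  have /= := gap (x n) (x m.+2).
  rewrite /= in D1; rewrite !gt_max mulrA -expr2 => G.
  by apply: le_trans (G _); [lra | apply/and3P; split; lra].
(* Second rectangle: n, n + 1, m + 3, m + 2. *)
have D2 : d (x n) (x m.+2) <= s * (2 * h + d (x n.+1) (x m.+3)).
  apply: le_trans (orbit_dist_rect _ _ _) _; [clear -nm; lia..|].
  by rewrite ler_pM2l // (dC (x m.+3)) /=; lra.
rewrite -(ltr_pM2l s_gt0).
have D3 : s * d (x n) (x m.+2) <= s * (s * (2 * h + d (x n.+1) (x m.+3))).
  by rewrite ler_pM2l.
by lra.
Qed.

Lemma orbit_cauchy : brm_cauchy d x.
Proof.
apply/cvgr0Pnorm_lt => e e0.
have [N HN] := orbit_tail_lt e0.
exists ([set n | (N <= n)%N], [set n | (N <= n)%N]).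
  by split; exists N.
move=> [n m] [/= Nn Nm]; rewrite ger0_norm //.
have [nm|/ltnW mn] := leqP n m.
  by rewrite -(subnKC nm); exact: HN.
by rewrite dC -(subnKC mn); exact: HN.
Qed.

(** * Limits of orbits *)

(** This supplies the distinctness required by the rectangular inequality at a
    limit of the orbit and at its image. *)
Lemma orbit_avoids p : exists N, forall n, (N <= n)%N -> x n <> p.
Proof.
have [[n0 <-]|np] := pselect (exists n, x n = p).
  by exists n0.+1 => n n0n /orbit_inj nn0; move: n0n; rewrite nn0 ltnn.
by exists 0%N => n _ xnp; apply: np; exists n.
Qed.

Hypothesis varphi_lsc : brm_lsc d varphi.

Lemma orbit_limit_varphi0 z : brm_cvg d x z -> varphi z = 0.
Proof.
move=> xz; apply/eqP; rewrite eq_le varphi_ge0 andbT -lee_fin.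
have vx : varphi (x n) @[n --> \oo] --> (0 : R).
  apply/cvgr0Pnorm_lt => e e0.
  have [N _ small] := cvgr0_norm_lt _ orbit_steps_cvg0 _ e0.
  exists N => // n /small /=.
  rewrite !ger0_norm ?le_max ?addr_ge0 // gt_max => /andP[+ _].
  have := varphi_ge0 (T (x n)); have := d_ge0 (x n) (T (x n)).
  by rewrite /=; lra.
have /(@cvg_limn_einf_sup R) [<- _] :
    (varphi (x n))%:E @[n --> \oo] --> (0 : R)%:E.
  by apply: cvg_EFin; first exact: nearW.
exact: varphi_lsc.
Qed.

Lemma orbit_limit_fixpoint z : brm_cvg d x z -> T z = z.
Proof.
move=> xz; have vz := orbit_limit_varphi0 xz.
apply/esym/d_eq0/eqP/contraT; rewrite neq_lt ltNge d_ge0 /= => dz0.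
have vTz := varphi_ge0 (T z).
have L0 : 0 < d z (T z) + varphi (T z) by lra.
have [dl dl0 gap] := T_mk L0.
(* The detour through x_n and x_{n+1} adds at most 2 s h, less than the gap. *)
have h0 : 0 < dl / (3 * s) by rewrite divr_gt0 // mulr_gt0.
set h := dl / (3 * s) in h0.
have hdl : 3 * (s * h) = dl.
  by rewrite mulrA mulrC divfK // mulf_neq0 // gt_eqF.
have hs : h <= s * h by rewrite ler_peMl // ltW.
have [N _ small] := cvgr0_norm_lt _ orbit_steps_cvg0 _ h0.
have [N1 _ near_z] := cvgr0_norm_lt _ xz _ h0.
have [N2 avoid_z] := orbit_avoids z.
have [N3 avoid_Tz] := orbit_avoids (T z).
pose n := (N + N1 + N2 + N3)%N.
have /= : `|Num.max (a (x n)) (b n)| < h.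
  by apply: small; rewrite /= /n; clear; lia.
rewrite ger0_norm ?le_max ?addr_ge0 // gt_max => /andP[an _].
have /= : `|d (x n) z| < h by apply: near_z; rewrite /= /n; clear; lia.
rewrite ger0_norm // => dnz.
have vn := varphi_ge0 (x n); have /= vn1 := varphi_ge0 (x n.+1).
have := gap (x n) z; rewrite !gt_max vz !addr0 => G.
have {}G : s ^+ 2 * d (T (x n)) (T z) + varphi (T (x n)) + varphi (T z)
    <= d z (T z) + varphi (T z) - dl.
  have dn := d_ge0 (x n) (T (x n)).
  by apply: G; apply/and3P; split; lra.
have D : d z (T z) <= s * (d z (x n) + d (x n) (T (x n)) + d (T (x n)) (T z)).
  apply: (brm_rect d_metric).
  - by move/(@orbit_inj n n.+1); clear; lia.
  - by apply: avoid_z; rewrite /n; clear; lia.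
  - by apply: avoid_Tz; rewrite /n; clear; lia.
  - by apply: (avoid_z n.+1); rewrite /n; clear; lia.
  - by apply: (avoid_Tz n.+1); rewrite /n; clear; lia.
have D' : s * (d z (x n) + d (x n) (T (x n)) + d (T (x n)) (T z)) <=
    s * (2 * h + d (T (x n)) (T z)).
  by rewrite ler_pM2l // (dC z); lra.
have [_ ?] := d_s2 (T (x n)) (T z).
by have := mulr_gt0 s_gt0 h0; lra.
Qed.

End Orbit.

Theorem theorem3p2 (R : realType) (X : Type) (s : R) (d : X -> X -> R)
    (T : X -> X) (varphi : X -> R)
    (X_nonempty : inhabited X)
    (s_ge1 : 1 <= s)
    (d_metric : b_rectangular_metric s d)
    (d_complete : brm_complete d)
    (varphi_ge0 : forall x, 0 <= varphi x)
    (varphi_lsc : brm_lsc d varphi)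
    (T_contractive : C_class_generalized_weakly_contractive s d varphi T) :
  exists z : X, unique (fun x => T x = x) z /\ varphi z = 0.
Proof.
have T_mk := C_class_meir_keeler d_metric varphi_ge0 T_contractive.
suff [z Tz] : exists z, T z = z.
  exists z; split; last exact: (fixpoint_varphi0 d_metric varphi_ge0 T_mk Tz).
  by split=> // y; exact: (fixpoint_unique s_ge1 d_metric varphi_ge0 T_mk Tz).
have [x0] := X_nonempty; pose x n := iter n T x0.
have [|no_fix] := pselect (exists n, T (x n) = x n).
  by case=> n Tx; exists (x n).
have step_gt0 n : 0 < d (x n) (T (x n)) + varphi (x n) + varphi (T (x n)).
  rewrite -addrA ltr_pwDl ?addr_ge0 // lt_neqAle (brm_ge0 d_metric) andbT.
  apply/eqP => /esym/(brm_eq0 d_metric) xT.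
  by apply: no_fix; exists n.
have [z xz] : exists z, brm_cvg d x z.
  exact/d_complete/(orbit_cauchy s_ge1 d_metric varphi_ge0 T_mk step_gt0).
exists z.
exact: (orbit_limit_fixpoint s_ge1 d_metric varphi_ge0 T_mk step_gt0
  varphi_lsc xz).
Qed.
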